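(* Let $\mathcal{R}$ be a weak rectangulation of size $n$. Then $\mathcal{R}$ avoids the pattern $\top$ (i.e. every vertical segment of $\mathcal{R}$ has its upper endpoint on the top side of the bounding rectangle) if and only if the permutation $\beta(\mathcal{R})\in S_n$ avoids the permutation pattern $213$.
   Context: A rectangulation of an axis-aligned rectangle $R$ is a decomposition of $R$ into finitely many interior-disjoint axis-aligned rectangles; its size is the number of rectangles. A segment is a maximal straight line segment which is a union of sides of rectangles and is not contained in the boundary of $R$. Rectangulations are generic: no two segments cross, so every endpoint of a segment lies either on the boundary of $R$ or in the interior of a perpendicular segment. The sides of $R$ are $\mathrm{N}$ (top), $\mathrm{S}$ (bottom), $\mathrm{W}$ (left), $\mathrm{E}$ (right). For rectangles $X,Y$: $Y$ is right of $X$ ($X$ is left of $Y$) if there is a sequence $X=X_1,\dots,X_k=Y$ such that for every $i$ there is a vertical segment containing the right side of $X_i$ and the left side of $X_{i+1}$; $Y$ is above $X$ ($X$ is below $Y$) if there is such a sequence with horizontal segments containing the top side of $X_i$ and the bottom side of $X_{i+1}$. Every pair of distinct rectangles satisfies exactly one of: left of, right of, above, below. Two rectangulations are weakly equivalent if there is a bijection between their rectangles preserving the left–right and above–below relations; a weak rectangulation is a weak equivalence class. A (weak) rectangulation avoids the pattern $\top$ if no vertical segment has its upper endpoint in the interior of a horizontal segment. The SE–NW ordering of the rectangles is the linear order with $X\prec Y$ iff $X$ is right of or below $Y$; the SW–NE ordering is the linear order with $X\prec Y$ iff $X$ is left of or below $Y$. The permutation $\beta(\mathcal{R})=\pi_1\cdots\pi_n$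 is defined by: label the rectangles $1,\dots,n$ according to the SE–NW ordering, and let $\pi_j$ be the label of the $j$-th rectangle in the SW–NE ordering. A permutation avoids $213$ if it has no indices $i<j<k$ with $\pi_j<\pi_i<\pi_k$. *)

(* Defs.v *)
From HB Require Import structures.
From Stdlib Require Import Relation_Operators.
From mathcomp Require Import all_boot all_order all_algebra all_fingroup.
From mathcomp Require Import boolp classical_sets reals.

Set Implicit Arguments.
Unset Strict Implicit.
Unset Printing Implicit Defensive.

Import Order.TTheory GRing.Theory Num.Theory.
Local Open Scope classical_set_scope.
Local Open Scope ring_scope.

Record rect (R : realType) := Rect {
  xlo : R; xhi : R; ylo : R; yhi : R;
  xlo_lt_xhi : xlo < xhi;
  ylo_lt_yhi : ylo < yhi }.

Definition rect_set (R : realType) (A : rect R) : set (R * R) :=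
  [set p | xlo A <= p.1 <= xhi A /\ ylo A <= p.2 <= yhi A].

Definition rect_int (R : realType) (A : rect R) : set (R * R) :=
  [set p | xlo A < p.1 < xhi A /\ ylo A < p.2 < yhi A].

Definition rect_boundary (R : realType) (A : rect R) : set (R * R) :=
  rect_set A `\` rect_int A.

(* A nondegenerate axis-parallel line segment: {pos} x [lo, hi] if vertical,
   and [lo, hi] x {pos} otherwise. *)
Record lseg (R : realType) := LSeg {
  vertical : bool; pos : R; lo : R; hi : R;
  lo_lt_hi : lo < hi }.

Definition lseg_set (R : realType) (s : lseg R) : set (R * R) :=
  [set p | if vertical s then p.1 = pos s /\ lo s <= p.2 <= hi s
           else p.2 = pos s /\ lo s <= p.1 <= hi s].

Definition lseg_int (R : realType) (s : lseg R) : set (R * R) :=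
  [set p | if vertical s then p.1 = pos s /\ lo s < p.2 < hi s
           else p.2 = pos s /\ lo s < p.1 < hi s].

Definition west_side (R : realType) (A : rect R) :=
  LSeg true (xlo A) (ylo_lt_yhi A).
Definition east_side (R : realType) (A : rect R) :=
  LSeg true (xhi A) (ylo_lt_yhi A).
Definition south_side (R : realType) (A : rect R) :=
  LSeg false (ylo A) (xlo_lt_xhi A).
Definition north_side (R : realType) (A : rect R) :=
  LSeg false (yhi A) (xlo_lt_xhi A).

Definition is_side_of (R : realType) (A : rect R) : set (lseg R) :=
  [set west_side A] `|` [set east_side A]
  `|` [set south_side A] `|` [set north_side A].

(* The n rectangles are named by 'I_n; the names carry no geometric meaning. *)
Record decomposition (R : realType) (n : nat) := Decomposition {
  box : rect R;
  tile : 'I_n -> rect R;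
  tile_cover : \bigcup_(X in [set: 'I_n]) rect_set (tile X) = rect_set box;
  tile_disjoint : forall X Y : 'I_n, X != Y ->
    rect_int (tile X) `&` rect_int (tile Y) = set0 }.

Definition union_of_sides (R : realType) (n : nat) (D : decomposition R n)
    (s : lseg R) : Prop :=
  exists2 S : set (lseg R),
    S `<=` \bigcup_(X in [set: 'I_n]) is_side_of (tile D X) &
    lseg_set s = \bigcup_(t in S) lseg_set t.

Definition is_segment (R : realType) (n : nat) (D : decomposition R n)
    (s : lseg R) : Prop :=
  [/\ union_of_sides D s,
      forall t : lseg R, union_of_sides D t ->
        lseg_set s `<=` lseg_set t -> lseg_set t = lseg_set s &
      ~ (lseg_set s `<=` rect_boundary (box D))].

(* Distinct parallel segments have disjoint interiors by maximality, so only
   perpendicular ones can cross. *)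
Definition generic (R : realType) (n : nat) (D : decomposition R n) : Prop :=
  forall s t : lseg R, is_segment D s -> is_segment D t ->
    vertical s -> ~~ vertical t -> lseg_int s `&` lseg_int t = set0.

Record rectangulation (R : realType) (n : nat) := Rectangulation {
  decomp :> decomposition R n;
  decomp_generic : generic decomp }.

Definition left_step (R : realType) (n : nat) (Q : rectangulation R n)
    (X Y : 'I_n) : Prop :=
  exists s : lseg R, [/\ is_segment Q s, vertical s,
    lseg_set (east_side (tile Q X)) `<=` lseg_set s &
    lseg_set (west_side (tile Q Y)) `<=` lseg_set s].

Definition below_step (R : realType) (n : nat) (Q : rectangulation R n)
    (X Y : 'I_n) : Prop :=
  exists s : lseg R, [/\ is_segment Q s, ~~ vertical s,
    lseg_set (north_side (tile Q X)) `<=` lseg_set s &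
    lseg_set (south_side (tile Q Y)) `<=` lseg_set s].

(* Chains have at least one step, so that the orders below are strict. *)
Definition left_of (R : realType) (n : nat) (Q : rectangulation R n) :
    'I_n -> 'I_n -> Prop := clos_trans _ (left_step Q).

Definition below (R : realType) (n : nat) (Q : rectangulation R n) :
    'I_n -> 'I_n -> Prop := clos_trans _ (below_step Q).

Definition right_of (R : realType) (n : nat) (Q : rectangulation R n)
    (X Y : 'I_n) : Prop := left_of Q Y X.

Definition weakly_equivalent (R : realType) (n : nat)
    (Q Q' : rectangulation R n) : Prop :=
  exists f : 'S_n, forall X Y : 'I_n,
    (left_of Q X Y <-> left_of Q' (f X) (f Y)) /\
    (below Q X Y <-> below Q' (f X) (f Y)).

Record weak_rectangulation (R : realType) (n : nat) := WeakRectangulation {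
  weak_class : set (rectangulation R n);
  weak_classP : exists Q : rectangulation R n,
    weak_class = [set Q' | weakly_equivalent Q Q'] }.

Definition avoids_top (R : realType) (n : nat) (Q : rectangulation R n) :
    Prop :=
  ~ exists s t : lseg R, [/\ is_segment Q s, vertical s,
      is_segment Q t, ~~ vertical t & lseg_int t (pos s, hi s)].

Definition se_nw (R : realType) (n : nat) (Q : rectangulation R n)
    (X Y : 'I_n) : Prop := right_of Q X Y \/ below Q X Y.

Definition sw_ne (R : realType) (n : nat) (Q : rectangulation R n)
    (X Y : 'I_n) : Prop := left_of Q X Y \/ below Q X Y.

(* The permutation r sends X to its (0-based) position in the strict linear
   order prec. *)
Definition is_ranking (n : nat) (prec : 'I_n -> 'I_n -> Prop) (r : 'S_n) :
    Prop :=
  forall X Y : 'I_n, prec X Y <-> (r X < r Y)%N.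

Definition is_beta (R : realType) (n : nat) (Q : rectangulation R n)
    (p : 'S_n) : Prop :=
  exists label position : 'S_n,
    [/\ is_ranking (se_nw Q) label, is_ranking (sw_ne Q) position &
        forall X : 'I_n, p (position X) = label X].

(* The permutation read off any representative; the default 1 is never used,
   since both orders are linear and depend only on the weak class. *)
Definition beta (R : realType) (n : nat) (W : weak_rectangulation R n) : 'S_n :=
  xget 1%g [set p | exists2 Q : rectangulation R n, weak_class W Q & is_beta Q p].

Definition avoids_213 (n : nat) (p : 'S_n) : Prop :=
  ~ exists i j k : 'I_n, [/\ (i < j)%N, (j < k)%N, (p j < p i)%N & (p i < p k)%N].

(* Main.v *)
(* A 213 pattern in beta is a triple of rectangles X, Y, Z with X left of Y and
   both X and Y below Z. If a vertical segment ends in the interior of a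
   horizontal one, the two rectangles at its top and any rectangle above it
   form such a triple. If instead all vertical segments reach the top of the
   box, then whatever is above X stays on the left of the segment along the
   right side of X, whatever is above Y stays on the right of the segment along
   the left side of Y, and there is no room for Z.

   That exactly one of the four relations holds between distinct X and Y is
   clear when their projections on some axis overlap. Otherwise, up to symmetry,
   Y lies north-east of X. Follow the staircase from the north-east corner of X
   that runs along each segment up to its end, then along the segment in which
   it ends, and so on, until it passes Y. If Y is above the staircase then Y is
   above X, and no left-right chain from X reaches Y since its vertical segments
   cannot cross the horizontal parts of the staircase; if Y is below it,
   exchange the axes. *)

Require Import Defs.
From Stdlib Require Import Relation_Operators Operators_Properties.
From mathcomp Require Import all_boot all_order all_algebra all_fingroup.
From mathcomp Require Import boolp classical_sets reals.
From mathcomp Require Import lra.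

Set Implicit Arguments.
Unset Strict Implicit.
Unset Printing Implicit Defensive.

Import Order.TTheory GRing.Theory Num.Theory.
Local Open Scope classical_set_scope.
Local Open Scope ring_scope.

(** * Tilings in coordinates, and chains of tiles along an axis *)

(* The boolean is an axis, true for x and false for y. [seg v p l h] stands for
   a segment of constant coordinate p on axis v, extending from l to h on the
   other axis; hence [seg true] is for vertical segments. *)
Record tiling (R : realFieldType) (n : nat) := Tiling {
  tlo : bool -> 'I_n -> R;
  thi : bool -> 'I_n -> R;
  blo : bool -> R;
  bhi : bool -> R;
  seg : bool -> R -> R -> R -> Prop;
  tlo_lt_thi : forall v X, tlo v X < thi v X;
  tile_in_box : forall v X, blo v <= tlo v X /\ thi v X <= bhi v;
  tile_sep : forall X Y, X <> Y ->
    exists v, thi v X <= tlo v Y \/ thi v Y <= tlo v X;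
  tile_at : forall a : bool -> R, (forall v, blo v <= a v /\ a v <= bhi v) ->
    exists X, forall v, tlo v X <= a v /\ a v <= thi v X;
  seg_box : forall v p l h, seg v p l h ->
    [/\ blo v < p, p < bhi v, blo (~~ v) <= l, l < h & h <= bhi (~~ v)];
  seg_avoid : forall v p l h X, seg v p l h -> tlo v X < p -> p < thi v X ->
    h <= tlo (~~ v) X \/ thi (~~ v) X <= l;
  seg_max : forall v p l h X, seg v p l h -> p = tlo v X \/ p = thi v X ->
    tlo (~~ v) X <= h -> l <= thi (~~ v) X ->
    l <= tlo (~~ v) X /\ thi (~~ v) X <= h;
  seg_exists : forall v p X, p = tlo v X \/ p = thi v X ->
    blo v < p -> p < bhi v ->
    exists l h, [/\ seg v p l h, l <= tlo (~~ v) X & thi (~~ v) X <= h];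
  seg_nocross : forall v p l h q l' h', seg v p l h -> seg (~~ v) q l' h' ->
    l < q -> q < h -> l' < p -> p < h' -> False }.

Definition step (R : realFieldType) n (T : tiling R n) (v : bool)
    (X Y : 'I_n) : Prop :=
  exists l h, [/\ seg T v (thi T v X) l h, tlo T v Y = thi T v X,
    l <= tlo T (~~ v) X /\ thi T (~~ v) X <= h &
    l <= tlo T (~~ v) Y /\ thi T (~~ v) Y <= h].

Definition chain (R : realFieldType) n (T : tiling R n) (v : bool) :
    'I_n -> 'I_n -> Prop := clos_trans _ (step T v).

Definition chain_eq (R : realFieldType) n (T : tiling R n) v (X Y : 'I_n) :
    Prop := X = Y \/ chain T v X Y.

Lemma chain_eq_chain (R : realFieldType) n (T : tiling R n) v X Y Z :
  chain_eq T v X Y -> chain T v Y Z -> chain T v X Z.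
Proof. by case=> [->|h] // h'; apply: t_trans h h'. Qed.

Lemma chain_chain_eq (R : realFieldType) n (T : tiling R n) v X Y Z :
  chain T v X Y -> chain_eq T v Y Z -> chain T v X Z.
Proof. by move=> h [<-|h'] //; apply: t_trans h h'. Qed.

Lemma chain_eq_trans (R : realFieldType) n (T : tiling R n) v X Y Z :
  chain_eq T v X Y -> chain_eq T v Y Z -> chain_eq T v X Z.
Proof. by move=> h [<-|h'] //; right; apply: chain_eq_chain h h'. Qed.

Lemma chain_le (R : realFieldType) n (T : tiling R n) v X Y :
  chain T v X Y -> thi T v X <= tlo T v Y.
Proof.
elim=> [U V [l [h [_ -> _ _]]] //|U V W _ h1 _ h2].
by have := tlo_lt_thi T v V; lra.
Qed.

(** * Tiles on a given side of a point *)

(** Well-founded because finitely many indices have a larger value of [f]. It serves arguments that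
    advance towards larger coordinates. *)
Lemma ord_ind_increasing (R : realFieldType) n (f : 'I_n -> R)
    (P : 'I_n -> Prop) :
  (forall X, (forall Y, f X < f Y -> P Y) -> P X) -> forall X, P X.
Proof.
move=> IH X.
have [k] := ubnP #|[pred Z | f X < f Z]|.
elim: k X => // k IHk X lek; apply: IH => Y ltXY; apply: IHk.
rewrite -ltnS; apply: leq_trans lek; rewrite ltnS; apply: proper_card.
apply/properP; split.
  by apply/fintype.subsetP => Z; rewrite !inE; apply: lt_trans.
by exists Y; rewrite !inE // ltxx.
Qed.

Lemma pos_lower_bound (R : realFieldType) (s : seq R) :
  exists2 e, 0 < e & forall z, z \in s -> 0 < z -> e < z.
Proof.
elim: s => [|y s [e e0 He]]; first by exists 1 => //; lra.
have [y0|y0] := ltP 0 y.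
  exists (Order.min e (y / 2)); first by rewrite lt_min; apply/andP; split; lra.
  move=> z; rewrite inE => /orP[/eqP->|zs] z0; rewrite gt_min.
    by apply/orP; right; lra.
  by rewrite He.
exists e => // z; rewrite inE => /orP[/eqP->|zs] z0; last exact: He.
by lra.
Qed.

(* [near true] is membership in [lo, hi), [near false] in (lo, hi]: it says that
   x lies in the closed interval together with the points just above,
   respectively just below, x. *)
Definition near (R : realFieldType) (d : bool) (lo x hi : R) : Prop :=
  if d then lo <= x /\ x < hi else lo < x /\ x <= hi.

(** Shift the point slightly in the directions [d] and take a tile containing the shifted point. *)
Lemma tile_near_fun (R : realFieldType) n (T : tiling R n) (d : bool -> bool)
    (a : bool -> R) :
  (forall v, near (d v) (blo T v) (a v) (bhi T v)) ->
  exists X, forall v, near (d v) (tlo T v X) (a v) (thi T v X).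
Proof.
move=> Ha.
(* The positive entries are the distances to the box sides, to low sides above [a v] and to high
   sides below it. A shift by a smaller [e] reaches none of them. *)
pose s v := [:: bhi T v - a v; a v - blo T v]
  ++ [seq tlo T v Z - a v | Z <- enum 'I_n]
  ++ [seq a v - thi T v Z | Z <- enum 'I_n].
have [e e0 He] := pos_lower_bound (s true ++ s false).
have He' v z : z \in s v -> 0 < z -> e < z.
  by move=> zs; apply: He; rewrite mem_cat; case: v zs => ->; rewrite ?orbT.
pose a' v := if d v then a v + e else a v - e.
have [v|X HX] := @tile_at _ _ T a'.
  have := Ha v; rewrite /a' /near; case: (d v) => -[h1 h2].
    have : e < bhi T v - a v by apply: (He' v); rewrite ?inE ?eqxx //; lra.
    by split; lra.
  have : e < a v - blo T v by apply: (He' v); rewrite ?inE ?eqxx ?orbT //; lra.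
  by split; lra.
exists X => v; have := HX v; rewrite /a' /near; case: (d v) => -[h1 h2].
  split; last by lra.
  rewrite leNgt; apply/negP => lt1.
  have : e < tlo T v X - a v; last by lra.
  apply: (He' v); last by lra.
  by rewrite !mem_cat; apply/or3P/Or32/mapP; exists X => //; rewrite mem_enum.
split; first by lra.
rewrite leNgt; apply/negP => lt1.
have : e < a v - thi T v X; last by lra.
apply: (He' v); last by lra.
by rewrite !mem_cat; apply/or3P/Or33/mapP; exists X => //; rewrite mem_enum.
Qed.

Lemma tile_near (R : realFieldType) n (T : tiling R n) d e v x y :
  near d (blo T v) x (bhi T v) -> near e (blo T (~~ v)) y (bhi T (~~ v)) ->
  exists X, near d (tlo T v X) x (thi T v X) /\
            near e (tlo T (~~ v) X) y (thi T (~~ v) X).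
Proof.
move=> Hx Hy.
have [u|X HX] := @tile_near_fun _ _ T (fun u => if u == v then d else e)
  (fun u => if u == v then x else y).
  by case: u v Hx Hy => [] [].
exists X; have := HX true; have := HX false.
by case: v {Hx Hy HX} => h1 h2; split.
Qed.

(** * Tiles with overlapping projections *)

Lemma tile_sep_axis (R : realFieldType) n (T : tiling R n) v X Y y :
  X <> Y ->
  tlo T (~~ v) X <= y < thi T (~~ v) X ->
  tlo T (~~ v) Y <= y < thi T (~~ v) Y ->
  thi T v X <= tlo T v Y \/ thi T v Y <= tlo T v X.
Proof.
move=> nXY /andP[X1 X2] /andP[Y1 Y2]; have [u] := tile_sep T nXY.
by case: u v X1 X2 Y1 Y2 => [] [] //= *; lra.
Qed.

(** Walk from [X] towards [Y] along the line at height [y], from each tile to the next one that the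
    line meets. *)
Lemma overlap_chain (R : realFieldType) n (T : tiling R n) v X Y y :
  tlo T (~~ v) X <= y < thi T (~~ v) X ->
  tlo T (~~ v) Y <= y < thi T (~~ v) Y ->
  tlo T v X < thi T v Y -> chain_eq T v X Y.
Proof.
move=> HX HY; elim/(ord_ind_increasing (f := tlo T v)): X HX => X IH HX ltXY.
have [->|/eqP nXY] := eqVneq X Y; first by left.
have {}ltXY : thi T v X <= tlo T v Y.
  by case: (tile_sep_axis nXY HX HY) => //; lra.
have X1 := tlo_lt_thi T v X; have Y1 := tlo_lt_thi T v Y.
have [X2 X3] := tile_in_box T v X; have [Y2 Y3] := tile_in_box T v Y.
have [X4 X5] := tile_in_box T (~~ v) X.
have [y1 y2] := andP HX; have [y3 y4] := andP HY.
(* [Z] is the tile just past the high side of [X]; separation from [X] forces its low side onto that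
   side. *)
have [||Z [[Z1 Z2] [Z3 Z4]]] := @tile_near _ _ T true true v (thi T v X) y.
- by split; lra.
- by split; lra.
have HZ : tlo T (~~ v) Z <= y < thi T (~~ v) Z by apply/andP.
have nXZ : X <> Z by move=> E; rewrite -E in Z2; lra.
have eXZ : tlo T v Z = thi T v X.
  by case: (tile_sep_axis nXZ HX HZ) => ?; lra.
right; apply: (@chain_chain_eq _ _ _ _ _ Z).
  have [|||l [h [s1 s2 s3]]] := @seg_exists _ _ T v (thi T v X) X.
  - by right.
  - by lra.
  - by lra.
  apply: t_step; exists l, h; split=> //.
  by apply: (seg_max s1); [left|lra|lra].
by apply: IH => //; lra.
Qed.

(** * Ends of segments, and staircases *)

(** [A] and [B] are the tiles just below the end, on the two sides of the segment. Maximality makes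
    both stop at [h], and the perpendicular segment along the high side of [A] must contain that of
    [B] too. So [p] is strictly inside its extent. *)
Lemma seg_end (R : realFieldType) n (T : tiling R n) v p l h :
  seg T v p l h -> h < bhi T (~~ v) ->
  exists A B l' h', [/\ thi T v A = p /\ thi T (~~ v) A = h,
    tlo T v B = p /\ thi T (~~ v) B = h, seg T (~~ v) h l' h',
    l' <= tlo T v A & thi T v B <= h'].
Proof.
move=> s hb; have [p1 p2 l1 lh _] := seg_box s.
have [||A [[A1 A2] [A3 A4]]] := @tile_near _ _ T false false v p h.
- by split; lra.
- by split; lra.
have [||B [[B1 B2] [B3 B4]]] := @tile_near _ _ T true false v p h.
- by split; lra.
- by split; lra.
(* A tile extending past [p] would be cut by the segment. *)
have eA : thi T v A = p.
  have [lt|lt|//] := ltgtP (thi T v A) p; first by lra.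
  by case: (seg_avoid s A1 lt); lra.
have eB : tlo T v B = p.
  have [lt|lt|//] := ltgtP (tlo T v B) p; last by lra.
  by case: (seg_avoid s lt B2); lra.
have [A5 A6] : l <= tlo T (~~ v) A /\ thi T (~~ v) A <= h.
  by apply: (seg_max s); [right|lra|lra].
have [B5 B6] : l <= tlo T (~~ v) B /\ thi T (~~ v) B <= h.
  by apply: (seg_max s); [left|lra|lra].
have [|||l' [h' [t t1 t2]]] := @seg_exists _ _ T (~~ v) h A.
- by right; lra.
- by have := tile_in_box T (~~ v) A; lra.
- by [].
rewrite negbK in t1 t2.
have [|||_ B7] := @seg_max _ _ T _ _ _ _ B t (or_intror _).
- by lra.
- by rewrite negbK; lra.
- by rewrite negbK; have := tlo_lt_thi T v A; have := tlo_lt_thi T v B; lra.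
rewrite negbK in B7.
by exists A, B, l', h'; split=> //; split=> //; lra.
Qed.

(* A staircase of segments starting at (a, b), the coordinate on axis v being
   written first, rising along v and ~~ v and passing under Y. No chain along v
   that starts under it reaches Y. *)
Inductive barrier (R : realFieldType) n (T : tiling R n) (v : bool)
    (Y : 'I_n) : R -> R -> Prop :=
| barrier_end a b l h : seg T (~~ v) b l h -> l < a -> tlo T v Y < h ->
    b <= tlo T (~~ v) Y -> barrier T v Y a b
| barrier_step a b l h b' : seg T (~~ v) b l h -> l < a -> b <= b' ->
    barrier T v Y h b' -> barrier T v Y a b.

Lemma barrier_le (R : realFieldType) n (T : tiling R n) v Y a b :
  barrier T v Y a b -> b <= tlo T (~~ v) Y.
Proof. by elim=> // *; lra. Qed.

(** Climb to the stair over the position [thi T v U]. The segment used by the step cannot cross it,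
    so [V] is under it as well, and the staircase from that stair on is the new barrier. *)
Lemma barrier_step_under (R : realFieldType) n (T : tiling R n) v Y a b U V :
  barrier T v Y a b -> step T v U V -> tlo T v V <= tlo T v Y ->
  a <= thi T v U -> thi T (~~ v) U <= b ->
  exists a' b', [/\ barrier T v Y a' b', a' <= thi T v V &
    thi T (~~ v) V <= b'].
Proof.
move=> + [l [h [s eV [U1 U2] [V1 V2]]]] leVY.
have U3 := tlo_lt_thi T (~~ v) U; have V3 := tlo_lt_thi T v V.
have stop a0 b0 l0 h0 : seg T (~~ v) b0 l0 h0 -> l0 < a0 ->
    a0 <= thi T v U -> thi T (~~ v) U <= b0 -> thi T v U < h0 ->
    thi T (~~ v) V <= b0.
  move=> s0 la aU Ub Uh; rewrite leNgt; apply/negP => lt.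
  by apply: (seg_nocross s s0); lra.
elim=> [a0 b0 l0 h0 s0 la Yh bY aU Ub|a0 b0 l0 h0 b' s0 la bb' B IH aU Ub].
  exists a0, b0; split; [exact: barrier_end s0 la Yh bY|lra|].
  by apply: stop s0 la aU Ub _; lra.
have [lt|ge] := ltP (thi T v U) h0; last by apply: IH; lra.
exists a0, b0; split; [exact: barrier_step s0 la bb' B|lra|].
exact: stop s0 la aU Ub lt.
Qed.

(** A chain stays under the staircase, so [Y] would end under a stair that is not above its own low
    side. *)
Lemma barrier_not_chain (R : realFieldType) n (T : tiling R n) v Y a b U :
  barrier T v Y a b -> a <= thi T v U -> thi T (~~ v) U <= b ->
  ~ chain T v U Y.
Proof.
move=> B aU Ub /clos_trans_t1n_iff c.
elim: c a b B aU Ub => {U} [U Y' s|U V Y' s c IH] a b B aU Ub; last first.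
  have /clos_trans_t1n_iff/chain_le VY := c; have V1 := tlo_lt_thi T v V.
  have [|a' [b' [B' a'V Vb']]] := barrier_step_under B s _ aU Ub; first by lra.
  exact: IH B' a'V Vb'.
have [|a' [b' [/barrier_le B' _ Y1]]] := barrier_step_under B s _ aU Ub.
  by [].
by have := tlo_lt_thi T (~~ v) Y'; lra.
Qed.

(* The staircase starts along v, from the corner shared by A and B. Its corners
   where the direction changes from ~~ v to v form the barrier against chains
   along v, the other ones the barrier against chains along ~~ v. *)
Lemma staircase (R : realFieldType) n (T : tiling R n) v X Y A B l h :
  seg T (~~ v) (thi T (~~ v) A) l h -> l < thi T v A < h ->
  thi T v A <= tlo T v Y -> thi T (~~ v) A <= tlo T (~~ v) Y ->
  tlo T v B = thi T v A -> thi T (~~ v) B = thi T (~~ v) A ->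
  chain_eq T (~~ v) X A -> chain_eq T v X B ->
  (chain T (~~ v) X Y /\ barrier T v Y (thi T v A) (thi T (~~ v) A)) \/
  (chain T v X Y /\
    exists2 a, thi T v A < a & barrier T (~~ v) Y (thi T (~~ v) A) a).
Proof.
(* The corner advances at every turn. The sum of its coordinates is symmetric, so the measure
   survives the exchange of axes. *)
elim/(ord_ind_increasing (f := fun Z => thi T true Z + thi T false Z)): A
  v B l h => A IH v B l h t /andP[lA Ah] aY bY eB1 eB2 XA XB.
have [b1 b2 l1 lh h1] := seg_box t; rewrite negbK in l1 h1.
have A1 := tlo_lt_thi T v A; have A2 := tlo_lt_thi T (~~ v) A.
have B1 := tlo_lt_thi T v B; have B2 := tlo_lt_thi T (~~ v) B.
have Y1 := tlo_lt_thi T v Y; have Y2 := tlo_lt_thi T (~~ v) Y.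
have [_ Y3] := tile_in_box T v Y; have [_ Y4] := tile_in_box T (~~ v) Y.
have onA : l <= tlo T v A /\ thi T v A <= h.
  by have := @seg_max _ _ T _ _ _ _ A t; rewrite negbK; apply; [right|lra|lra].
have stepA Z : tlo T (~~ v) Z = thi T (~~ v) A -> tlo T v Z <= h ->
    l <= thi T v Z -> step T (~~ v) A Z.
  move=> eZ Z1 Z2; exists l, h; rewrite negbK; split=> //.
  by have := @seg_max _ _ T _ _ _ _ Z t; rewrite negbK; apply; [left|lra|lra].
(* If this stair passes under [Y], then [A] steps across it to the tile [Z] at coordinate
   [tlo T v Y], whose projection overlaps that of [Y]. *)
have [Yh|hY] := ltP (tlo T v Y) h.
  left; split; last exact: barrier_end t lA Yh bY.
  have [||Z [[Z1 Z2] [Z3 Z4]]] :=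
      @tile_near _ _ T true true v (tlo T v Y) (thi T (~~ v) A).
  - by split; lra.
  - by split; lra.
  have eZ : tlo T (~~ v) Z = thi T (~~ v) A.
    have [lt|lt|//] := ltgtP (tlo T (~~ v) Z) (thi T (~~ v) A); last by lra.
    by have := seg_avoid t lt Z4; rewrite negbK; lra.
  apply: chain_eq_chain XA _; apply: (@chain_chain_eq _ _ _ _ _ Z).
    by apply: t_step; apply: stepA eZ _ _; lra.
  apply: (@overlap_chain _ _ _ _ _ _ (tlo T v Y)); rewrite ?negbK; last by lra.
    by apply/andP.
  by apply/andP; split; lra.
(* Otherwise the stair ends inside a perpendicular segment, the next stair; the induction hypothesis
   is used there with the axes exchanged. *)
have [|A' [B' [l' [h' []]]]] := seg_end t; rewrite negbK; first by lra.
move=> [eA1 eA2] [eB1' eB2'] t' lA' Bh'.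
have A1' := tlo_lt_thi T v A'; have A2' := tlo_lt_thi T (~~ v) A'.
have B1' := tlo_lt_thi T v B'; have B2' := tlo_lt_thi T (~~ v) B'.
have := IH A' _ (~~ v) B' l' h'; rewrite negbK eA1 eA2 eB1' eB2'.
case=> //.
- have : thi T true A + thi T false A = thi T v A + thi T (~~ v) A.
    by case: (v) => /=; lra.
  have : thi T true A' + thi T false A' = thi T v A' + thi T (~~ v) A'.
    by case: (v) => /=; lra.
  by lra.
- by apply/andP; lra.
- apply: chain_eq_trans XB _.
  (* [B] and [A'] both have their high side on the stair, so their projections overlap just under
     it, in particular at [m]. *)
  pose m := Order.max (tlo T (~~ v) B) (tlo T (~~ v) A').
  have m1 : tlo T (~~ v) B <= m by rewrite le_max lexx.
  have m2 : tlo T (~~ v) A' <= m by rewrite le_max lexx orbT.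
  have m3 : m < thi T (~~ v) A by rewrite gt_max; apply/andP; lra.
  by apply: (@overlap_chain _ _ _ _ _ _ m); rewrite -?eB2 -?eA1;
    try (apply/andP); lra.
- by apply: chain_eq_trans XA _; right; apply: t_step; apply: stepA; lra.
- by case=> XY bar; right; split=> //; exists h.
- case=> XY [a' ltab bar]; left; split=> //.
  by apply: barrier_step t lA _ bar; lra.
Qed.

(** The segment along a side of [X] stops at its corner, hence inside a perpendicular segment. This
    is the first stair, with [X] in the role of [A]. *)
Lemma chain_xor_end (R : realFieldType) n (T : tiling R n) v X Y l :
  seg T v (thi T v X) l (thi T (~~ v) X) ->
  (forall u, thi T u X <= tlo T u Y) ->
  exists u, chain T u X Y /\ ~ chain T (~~ u) X Y.
Proof.
move=> s le; have le1 := le v; have le2 := le (~~ v).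
have X1 := tlo_lt_thi T v X; have X2 := tlo_lt_thi T (~~ v) X.
have Y2 := tlo_lt_thi T (~~ v) Y; have [_ Y3] := tile_in_box T (~~ v) Y.
have [|A [B [l' [h' [[A1 A2] [B1 B2] t lA Bh]]]]] := seg_end s.
  by lra.
have A3 := tlo_lt_thi T v A; have B3 := tlo_lt_thi T v B.
have B4 := tlo_lt_thi T (~~ v) B.
have [_ _ _ lt _] := seg_box s.
have XB : step T v X B.
  exists l, (thi T (~~ v) X); split=> //;
    apply: (seg_max s); [by right|lra|lra|by left|lra|lra].
have lX : l' < thi T v X < h' by apply/andP; lra.
have XB' : chain_eq T v X B by right; apply: t_step.
have [[c bar]|[c [a' a'X bar]]] :=
  staircase t lX le1 le2 B1 B2 (or_introl erefl) XB'.
  by exists (~~ v); rewrite negbK; split=> //; apply: barrier_not_chain bar _ _.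
exists v; split=> //; apply: barrier_not_chain bar _ _ => //.
by rewrite negbK ltW.
Qed.

(** The two segments along the high sides of [X] would cross if both continued past its corner, so
    one of them ends there. *)
Lemma chain_xor_diagonal (R : realFieldType) n (T : tiling R n) X Y :
  (forall u, thi T u X <= tlo T u Y) ->
  exists u, chain T u X Y /\ ~ chain T (~~ u) X Y.
Proof.
move=> le.
have side v : exists l h, [/\ seg T v (thi T v X) l h, l <= tlo T (~~ v) X &
    thi T (~~ v) X <= h].
  have := le v; have X1 := tlo_lt_thi T v X; have Y1 := tlo_lt_thi T v Y.
  have [X2 _] := tile_in_box T v X; have [_ Y2] := tile_in_box T v Y.
  by move=> ?; apply: seg_exists; [right|lra|lra].
have [l [h [s lX Xh]]] := side true; have [l' [h' [t lX' Xh']]] := side false.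
have X1 := tlo_lt_thi T true X; have X2 := tlo_lt_thi T false X.
rewrite /= in lX Xh lX' Xh'.
have [lt|ge] := ltP (thi T false X) h; last first.
  apply: (chain_xor_end (v := true) (l := l)) => //=.
  by have <- : h = thi T false X by lra.
have [lt'|ge'] := ltP (thi T true X) h'.
  by exfalso; apply: (seg_nocross s t); lra.
apply: (chain_xor_end (v := false) (l := l')) => //=.
by have <- : h' = thi T true X by lra.
Qed.

(** * Reflection, and the unique axis relating two tiles *)

(* The image under (x, y) |-> (x, - y). *)
Definition reflect_y (R : realFieldType) n (T : tiling R n) : tiling R n.
Proof.
apply: (@Tiling R n
  (fun v X => if v then tlo T v X else - thi T v X)
  (fun v X => if v then thi T v X else - tlo T v X)
  (fun v => if v then blo T v else - bhi T v)
  (fun v => if v then bhi T v else - blo T v)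
  (fun v p l h => if v then seg T v p (- h) (- l) else seg T v (- p) l h)).
- by case=> X; have := tlo_lt_thi T true X; have := tlo_lt_thi T false X; lra.
- by case=> X;
    have [] := tile_in_box T true X; have [] := tile_in_box T false X; lra.
- by move=> X Y /(tile_sep T)[] [] h; [exists true|exists false]; lra.
- move=> a Ha; pose a' v := if v then a v else - a v.
  have [|X HX] := @tile_at _ _ T a'.
    by rewrite /a'; case; [have := Ha true|have := Ha false]; lra.
  by exists X; case; [have := HX true|have := HX false]; rewrite /a'; lra.
- by case=> p l h /(@seg_box _ _ T)/= [] *; split; lra.
- case=> p l h X s h1 h2; first by have /= := seg_avoid s h1 h2; lra.
  have /= Hs := seg_avoid (X := X) s.
  by case: Hs; lra.
- case=> p l h X s pE /= h1 h2.
    by have /= Hs := seg_max s pE; case: Hs; lra.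
  by have /= Hs := seg_max (X := X) s; case: Hs; lra.
- case=> p X pE h1 h2.
    have [|||l [h [s s1 s2]]] := @seg_exists _ _ T true p X; try lra.
    by exists (- h), (- l); rewrite !opprK /=; split=> //=;
      rewrite /= in s1 s2; lra.
  have [|||l [h [s s1 s2]]] := @seg_exists _ _ T false (- p) X; try lra.
  by exists l, h.
- case=> p l h q l' h' s t *.
    by apply: (@seg_nocross _ _ T true _ _ _ _ _ _ s t); lra.
  by apply: (@seg_nocross _ _ T false _ _ _ _ _ _ s t); lra.
Defined.

Lemma chain_reflect_x (R : realFieldType) n (T : tiling R n) X Y :
  chain (reflect_y T) true X Y <-> chain T true X Y.
Proof.
split; elim=> {}X {}Y.
- move=> [l [h [/= s1 s2 s3 s4]]]; apply: t_step.
  by exists (- h), (- l); split=> //=; lra.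
- by move=> Z _ h1 _ h2; apply: t_trans h1 h2.
- move=> [l [h [/= s1 s2 s3 s4]]]; apply: t_step.
  by exists (- h), (- l); rewrite /= !opprK; split=> //; lra.
- by move=> Z _ h1 _ h2; apply: t_trans h1 h2.
Qed.

Lemma chain_reflect_y (R : realFieldType) n (T : tiling R n) X Y :
  chain (reflect_y T) false X Y <-> chain T false Y X.
Proof.
split; elim=> {}X {}Y.
- move=> [l [h [/= s1 s2 s3 s4]]]; apply: t_step.
  have e : thi T false Y = tlo T false X by lra.
  by exists l, h; rewrite e; rewrite opprK in s1; split.
- by move=> Z _ h1 _ h2; apply: t_trans h2 h1.
- move=> [l [h [/= s1 s2 s3 s4]]]; apply: t_step.
  by exists l, h; rewrite /= opprK s2; split=> //=; lra.
- by move=> Z _ h1 _ h2; apply: t_trans h2 h1.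
Qed.

Lemma chain_overlap (R : realFieldType) n (T : tiling R n) v X Y :
  X <> Y ->
  tlo T (~~ v) X < thi T (~~ v) Y -> tlo T (~~ v) Y < thi T (~~ v) X ->
  chain T v X Y \/ chain T v Y X.
Proof.
move=> nXY h1 h2.
have X1 := tlo_lt_thi T v X; have X2 := tlo_lt_thi T (~~ v) X.
have Y1 := tlo_lt_thi T v Y; have Y2 := tlo_lt_thi T (~~ v) Y.
pose m := Order.max (tlo T (~~ v) X) (tlo T (~~ v) Y).
have mX : tlo T (~~ v) X <= m < thi T (~~ v) X.
  by rewrite le_max lexx gt_max; apply/andP; split=> //; apply/andP.
have mY : tlo T (~~ v) Y <= m < thi T (~~ v) Y.
  by rewrite le_max lexx orbT gt_max; apply/andP; split=> //; apply/andP.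
have [lt|ge] := ltP (tlo T v X) (thi T v Y).
  by case: (overlap_chain mX mY lt) => // ?; left.
have lt : tlo T v Y < thi T v X by lra.
by case: (overlap_chain mY mX lt) => [/esym|] // ?; right.
Qed.

(** Overlapping projections allow chains along one axis only. Diagonal positions reduce, by
    exchanging the tiles and by reflection, to one tile beyond the other on both axes. *)
Lemma chain_comparable_unique (R : realFieldType) n (T : tiling R n) X Y :
  X <> Y -> exists v, (chain T v X Y \/ chain T v Y X) /\
    ~ (chain T (~~ v) X Y \/ chain T (~~ v) Y X).
Proof.
move=> nXY.
have X1 v := tlo_lt_thi T v X; have Y1 v := tlo_lt_thi T v Y.
have ov v : tlo T (~~ v) X < thi T (~~ v) Y ->
    tlo T (~~ v) Y < thi T (~~ v) X ->
    (chain T v X Y \/ chain T v Y X) /\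
    ~ (chain T (~~ v) X Y \/ chain T (~~ v) Y X).
  move=> h1 h2; split; first exact: chain_overlap.
  by case=> /chain_le; lra.
(* Stated for any [S], so that it applies to the reflected tiling too. *)
have diag (S : tiling R n) U V : (forall u, thi S u U <= tlo S u V) ->
    exists v, [/\ chain S v U V, ~ chain S (~~ v) U V, ~ chain S (~~ v) V U &
      forall u, ~ chain S u V U].
  move=> le; have no u : ~ chain S u V U.
    move=> /chain_le; have := le u; have := tlo_lt_thi S u U.
    by have := tlo_lt_thi S u V; lra.
  by have [v [v1 v2]] := chain_xor_diagonal le; exists v; split.
have Xt := X1 true; have Xf := X1 false.
have Yt := Y1 true; have Yf := Y1 false.
have [xXY|xXY] := ltP (tlo T true X) (thi T true Y); last first.
  have [yXY|yXY] := ltP (tlo T false X) (thi T false Y); last first.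
    have [|v [v1 v2 v3 v4]] := diag T Y X; first by case.
    by exists v; tauto.
  have [yYX|yYX] := ltP (tlo T false Y) (thi T false X).
    by exists true; apply: ov.
  have [|v [v1 v2 v3 v4]] := diag (reflect_y T) Y X; first by case=> /=; lra.
  have c1 := chain_reflect_x T X Y; have c2 := chain_reflect_x T Y X.
  have c3 := chain_reflect_y T X Y; have c4 := chain_reflect_y T Y X.
  have := v4 true; have := v4 false.
  by exists v; case: v v1 v2 v3 {v4} => /=; tauto.
have [xYX|xYX] := ltP (tlo T true Y) (thi T true X).
  by exists false; apply: ov.
have [yXY|yXY] := ltP (tlo T false X) (thi T false Y); last first.
  have [|v [v1 v2 v3 v4]] := diag (reflect_y T) X Y; first by case=> /=; lra.
  have c1 := chain_reflect_x T X Y; have c2 := chain_reflect_x T Y X.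
  have c3 := chain_reflect_y T X Y; have c4 := chain_reflect_y T Y X.
  have := v4 true; have := v4 false.
  by exists v; case: v v1 v2 v3 {v4} => /=; tauto.
have [yYX|yYX] := ltP (tlo T false Y) (thi T false X).
  by exists true; apply: ov.
have [|v [v1 v2 v3 v4]] := diag T X Y; first by case.
by exists v; have := v4 v; have := v4 (~~ v); tauto.
Qed.

(** * Top patterns as triples of tiles *)

Definition has_top (R : realFieldType) n (T : tiling R n) : Prop :=
  exists p l h l' h',
    [/\ seg T true p l h, seg T false h l' h', l' < p & p < h'].

(** The segment is a wall up to the top of the box. The horizontal segments of the chain lie above
    its lower end and under the top, so they cannot cross it. *)
Lemma below_stays_beside (R : realFieldType) n (T : tiling R n) p l U V :
  seg T true p l (bhi T false) -> chain T false U V -> l < thi T false U ->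
  (thi T true U <= p -> thi T true V <= p) /\
  (p <= tlo T true U -> p <= tlo T true V).
Proof.
move=> s c lU.
(* The added bound on [V] lets the claim compose along chains. *)
suff : [/\ l < thi T false V, thi T true U <= p -> thi T true V <= p &
    p <= tlo T true U -> p <= tlo T true V] by case.
elim: c lU => {}U {}V.
  move=> [l' [h' [/= t eV [U1 U2] [V1 V2]]]] lU.
  have [_ _ _ _ _] := seg_box s.
  have [t1 t2 _ _ _] := seg_box t.
  have U3 := tlo_lt_thi T true U; have V3 := tlo_lt_thi T false V.
  have V4 := tlo_lt_thi T true V.
  split; first by lra.
    move=> Up; rewrite leNgt; apply/negP => lt.
    by apply: (seg_nocross s t) => //; lra.
  move=> Up; rewrite leNgt; apply/negP => lt.
  by apply: (seg_nocross s t) => //; lra.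
move=> W _ IH1 _ IH2 lU; have [V1 V2 V3] := IH1 lU; have [W1 W2 W3] := IH2 V1.
by split; auto.
Qed.

Lemma chain_first_step (T : Type) (r : T -> T -> Prop) x y :
  clos_trans _ r x y -> exists2 z, r x z & z = y \/ clos_trans _ r z y.
Proof.
move=> /clos_trans_t1n_iff[z h|z w h /clos_trans_t1n_iff c]; exists z => //.
  by left.
by right.
Qed.

Lemma chain_last_step (T : Type) (r : T -> T -> Prop) x y :
  clos_trans _ r x y -> exists2 z, r z y & x = z \/ clos_trans _ r x z.
Proof.
move=> /clos_trans_tn1_iff[h|z w h /clos_trans_tn1_iff c].
  by exists x => //; left.
by exists z => //; right.
Qed.

Lemma has_topP (R : realFieldType) n (T : tiling R n) :
  has_top T <-> exists X Y Z,
    [/\ chain T true X Y, chain T false X Z & chain T false Y Z].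
Proof.
split=> [[p [l [h [l' [h' [s t lp ph]]]]]]|[X [Y [Z [XY XZ YZ]]]]].
  have [t1 t2 t3 t4 t5] := seg_box t; have [s1 s2 s3 s4 s5] := seg_box s.
  rewrite /= in t1 t2 t3 t5 s3 s5.
  have [//|A [B [l2 [h2 [[/= A1 A2] [/= B1 B2] _ _ _]]]]] := seg_end s.
  (* [Z] sits just above the junction, with its low side on the horizontal segment. *)
  have [||Z [/= [Z1 Z2] [Z3 Z4]]] := @tile_near _ _ T true true true p h.
  - by split; lra.
  - by split=> /=; lra.
  have eZ : tlo T false Z = h.
    have [lt|lt|//] := ltgtP (tlo T false Z) h; last by lra.
    by case: (seg_avoid t lt Z4) => /=; lra.
  have A3 := tlo_lt_thi T true A; have B3 := tlo_lt_thi T true B.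
  have A4 := tlo_lt_thi T false A; have B4 := tlo_lt_thi T false B.
  have up U : thi T false U = h -> tlo T true U <= h' -> l' <= thi T true U ->
      chain T false U Z.
    move=> eU U1 U2; apply: t_step; exists l', h'; rewrite eU; split=> //.
      by apply: (seg_max t); [right|..].
    by apply: (seg_max t) => /=; [left|lra|lra].
  exists A, B, Z; split; [|by apply: up => //; lra|by apply: up => //; lra].
  apply: t_step; exists l, h; rewrite A1; split=> //.
    by apply: (seg_max s) => /=; [right|lra|lra].
  by apply: (seg_max s) => /=; [left|lra|lra].
apply: contrapT => notop.
(* A vertical segment stopping earlier would, by [seg_end], form a top pattern. *)
have reach p l h : seg T true p l h -> seg T true p l (bhi T false).
  move=> s; have [_ _ _ _ s5] := seg_box s; rewrite /= in s5.
  suff : ~ h < bhi T false by move/negP; rewrite -leNgt => ?;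
    have <- : h = bhi T false by lra.
  move=> /(seg_end s)[A [B [l' [h' [/= [A1 A2] [B1 B2] t lA Bh]]]]].
  have A3 := tlo_lt_thi T true A; have B3 := tlo_lt_thi T true B.
  by apply: notop; exists p, l, h, l', h'; split=> //; lra.
(* The first and last segments of the chain run along the right side of [X] and the left side of
   [Y]. *)
have [U [l [h [/reach s _ [/= X1 _] _]]] _] := chain_first_step XY.
have [V [l2 [h2 [/reach t eY _ [/= Y1 _]]]] _] := chain_last_step XY.
have X2 := tlo_lt_thi T false X; have Y2 := tlo_lt_thi T false Y.
have Z1 := tlo_lt_thi T true Z.
have [|/(_ (lexx _)) Z2 _] := below_stays_beside s XZ; first by lra.
have [|_] := below_stays_beside t YZ; first by lra.
rewrite eY lexx => /(_ isT) Z3.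
(* [Z] ends no later than [X] does and starts no earlier than [Y], which leaves it no width. *)
by have := chain_le XY; lra.
Qed.

(** * Rectangles, sides and segments in coordinates *)

Definition coord (R : realType) (v : bool) (q : R * R) : R :=
  if v then q.1 else q.2.

Definition point (R : realType) (v : bool) (a b : R) : R * R :=
  if v then (a, b) else (b, a).

Lemma coord_point (R : realType) v (a b : R) : coord v (point v a b) = a.
Proof. by case: v. Qed.

Lemma coordN_point (R : realType) v (a b : R) : coord (~~ v) (point v a b) = b.
Proof. by case: v. Qed.

Definition rlo (R : realType) (v : bool) (A : rect R) : R :=
  if v then xlo A else ylo A.

Definition rhi (R : realType) (v : bool) (A : rect R) : R :=
  if v then xhi A else yhi A.

Lemma rlo_lt_rhi (R : realType) v (A : rect R) : rlo v A < rhi v A.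
Proof. by case: v; [apply: xlo_lt_xhi|apply: ylo_lt_yhi]. Qed.

Lemma rect_setP (R : realType) (A : rect R) q :
  rect_set A q <-> forall v, rlo v A <= coord v q <= rhi v A.
Proof.
split; first by case=> h1 h2; case.
by move=> h; split; [exact: (h true)|exact: (h false)].
Qed.

Lemma rect_intP (R : realType) (A : rect R) q :
  rect_int A q <-> forall v, rlo v A < coord v q < rhi v A.
Proof.
split; first by case=> h1 h2; case.
by move=> h; split; [exact: (h true)|exact: (h false)].
Qed.

Lemma lseg_setP (R : realType) (s : lseg R) q :
  lseg_set s q <-> coord (vertical s) q = pos s /\
    lo s <= coord (~~ vertical s) q <= hi s.
Proof. by rewrite /lseg_set /=; case: (vertical s). Qed.

Lemma lseg_intP (R : realType) (s : lseg R) q :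
  lseg_int s q <-> coord (vertical s) q = pos s /\
    lo s < coord (~~ vertical s) q < hi s.
Proof. by rewrite /lseg_int /=; case: (vertical s). Qed.

Lemma lseg_subP (R : realType) (s t : lseg R) :
  lseg_set s `<=` lseg_set t <->
  [/\ vertical s = vertical t, pos s = pos t, lo t <= lo s & hi s <= hi t].
Proof.
split=> [sub|[ev ep l1 h1] q].
  have lts := lo_lt_hi s.
  have end1 := sub (point (vertical s) (pos s) (lo s)).
  have end2 := sub (point (vertical s) (pos s) (hi s)).
  rewrite !lseg_setP !coord_point !coordN_point in end1 end2.
  have {end1} [|p1 /andP[l1 h1]] := end1; first by split=> //; apply/andP; lra.
  have {end2} [|p2 /andP[l2 h2]] := end2; first by split=> //; apply/andP; lra.
  case: (vertical s) (vertical t) p1 p2 l1 h1 l2 h2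
    => [] [] /= p1 p2 l1 h1 l2 h2.
  - by split.
  - by exfalso; lra.
  - by exfalso; lra.
  - by split.
rewrite !lseg_setP ev ep => -[-> /andP[h2 h3]]; split=> //.
by apply/andP; lra.
Qed.

(** Pointwise form of [union_of_sides]: every point lies on a tile side contained in the segment. *)
Definition covered (R : realType) n (D : decomposition R n) (v : bool)
    (p l h : R) : Prop :=
  forall b, l <= b <= h -> exists X,
    [/\ p = rlo v (tile D X) \/ p = rhi v (tile D X),
      l <= rlo (~~ v) (tile D X), rlo (~~ v) (tile D X) <= b,
      b <= rhi (~~ v) (tile D X) & rhi (~~ v) (tile D X) <= h].

Definition rect_side (R : realType) (v e : bool) (A : rect R) : lseg R :=
  LSeg v (if e then rhi v A else rlo v A) (rlo_lt_rhi (~~ v) A).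

Lemma is_side_ofP (R : realType) (A : rect R) (t : lseg R) :
  is_side_of A t <-> exists v e, t = rect_side v e A.
Proof.
have E : [/\ west_side A = rect_side true false A,
    east_side A = rect_side true true A,
    south_side A = rect_side false false A &
    north_side A = rect_side false true A].
  (* The segments differ only in their proofs of a boolean inequality. *)
  by split; rewrite /rect_side; congr LSeg; apply: bool_irrelevance.
case: E => E1 E2 E3 E4; rewrite /is_side_of /= E1 E2 E3 E4; split.
  by move=> [[[->|->]|->]|->]; eexists; eexists.
by move=> [[] [[] ->]]; tauto.
Qed.

Lemma union_of_sidesP (R : realType) n (D : decomposition R n) (s : lseg R) :
  union_of_sides D s <-> covered D (vertical s) (pos s) (lo s) (hi s).
Proof.
split=> [[S subS eS] b /andP[b1 b2]|cov].
  have : lseg_set s (point (vertical s) (pos s) b).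
    by rewrite lseg_setP coord_point coordN_point; split=> //; apply/andP.
  rewrite eS => -[t St tb].
  have /lseg_subP[ev ep l1 h1] : lseg_set t `<=` lseg_set s.
    by rewrite eS => q tq; exists t.
  have [X _ /is_side_ofP[v [e et]]] := subS t St.
  rewrite lseg_setP ev coord_point coordN_point in tb.
  move: ev ep l1 h1 tb; rewrite {}et /= => <- ep l1 h1 [_ /andP[b3 b4]].
  by exists X; split=> //; rewrite -ep; case: (e); [right|left].
exists [set t | (exists X, is_side_of (tile D X) t) /\
    lseg_set t `<=` lseg_set s].
  by move=> t [[X tX] _]; exists X.
apply/seteqP; split=> [q|q [t [_ sub]]]; last exact: sub.
rewrite lseg_setP => -[q1 q2]; have [X [X1 X2 X3 X4 X5]] := cov _ q2.
have [e pe] : exists e, pos s = pos (rect_side (vertical s) e (tile D X)).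
  by case: X1; [exists false|exists true].
exists (rect_side (vertical s) e (tile D X)).
  split; first by exists X; apply/is_side_ofP; eexists; eexists.
  by apply/lseg_subP; rewrite -pe.
by rewrite lseg_setP -pe /=; split=> //; apply/andP.
Qed.

(** * Segments as maximal covered intervals *)

(** The coordinate form of [is_segment]. For covered segments, not lying in the boundary of the box
    amounts to [p] being strictly inside. *)
Definition max_covered (R : realType) n (D : decomposition R n) (v : bool)
    (p l h : R) : Prop :=
  [/\ l < h, covered D v p l h,
    forall l' h', covered D v p l' h' -> l' <= l -> h <= h' ->
      l' = l /\ h' = h,
    rlo v (box D) < p & p < rhi v (box D)].

Lemma tile_sub_box (R : realType) n (D : decomposition R n) v X :
  rlo v (box D) <= rlo v (tile D X) /\ rhi v (tile D X) <= rhi v (box D).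
Proof.
have sub q : rect_set (tile D X) q -> rect_set (box D) q.
  by rewrite -(tile_cover D) => tq; exists X.
have lt u := ltW (rlo_lt_rhi u (tile D X)).
have inb a : rlo v (tile D X) <= a <= rhi v (tile D X) ->
    rlo v (box D) <= a <= rhi v (box D).
  move=> ha; set q := point v a (rlo (~~ v) (tile D X)).
  suff /sub/rect_setP/(_ v) : rect_set (tile D X) q by rewrite coord_point.
  apply/rect_setP => u; have [->|->] : u = v \/ u = ~~ v.
  - by case: (u) (v) => [] []; auto.
  - by rewrite coord_point.
  - by rewrite coordN_point lexx lt.
have /andP[-> _] : rlo v (box D) <= rlo v (tile D X) <= rhi v (box D).
  by apply: inb; rewrite lexx lt.
have /andP[_ ->] // : rlo v (box D) <= rhi v (tile D X) <= rhi v (box D).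
by apply: inb; rewrite lexx lt.
Qed.

Lemma is_segmentP (R : realType) n (D : decomposition R n) (s : lseg R) :
  is_segment D s <-> max_covered D (vertical s) (pos s) (lo s) (hi s).
Proof.
have lts := lo_lt_hi s.
split=> [[/union_of_sidesP cov smax sint]|[_ cov smax p1 p2]].
  have [|X [pX X1 X2 X3 X4]] := cov ((lo s + hi s) / 2).
    by apply/andP; lra.
  have [b1 b2] := tile_sub_box D (vertical s) X.
  have ltX := rlo_lt_rhi (vertical s) (tile D X).
  have onb : ~ (pos s = rlo (vertical s) (box D) \/
                pos s = rhi (vertical s) (box D)).
    move=> ep; apply: sint => q sq; split.
      rewrite -(tile_cover D); move: sq; rewrite lseg_setP => -[q1 q2].
      have [Z [Z1 Z2 Z3 Z4 Z5]] := cov _ q2.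
      exists Z => //; apply/rect_setP => u.
      have ltZ := rlo_lt_rhi (vertical s) (tile D Z).
      have : u = vertical s \/ u = ~~ vertical s.
        by case: (u) (vertical s) => [] []; auto.
      by case=> ->; apply/andP; lra.
    move=> /rect_intP/(_ (vertical s))/andP.
    by move: sq; rewrite lseg_setP => -[-> _]; lra.
  split=> //.
  - move=> l h cov' lel leh.
    have lth : l < h by lra.
    have := smax (LSeg (vertical s) (pos s) lth).
    rewrite union_of_sidesP /= => /(_ cov') eqs.
    have /lseg_subP[_ _ /= ? ?] :
        lseg_set (LSeg (vertical s) (pos s) lth) `<=` lseg_set s.
      by rewrite eqs //; apply/lseg_subP.
    by split; lra.
  - by have [lt|lt|e] := ltgtP (rlo (vertical s) (box D)) (pos s) => //;
      exfalso; [lra|apply: onb; left].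
  - by have [lt|lt|e] := ltgtP (pos s) (rhi (vertical s) (box D)) => //;
      exfalso; [lra|apply: onb; right].
split.
- exact/union_of_sidesP.
- move=> t /union_of_sidesP covt /[dup] sub /lseg_subP[ev ep l1 h1].
  apply/seteqP; split=> //; apply/lseg_subP.
  rewrite -ev -ep in covt; have [-> ->] := smax _ _ covt l1 h1.
  by split.
(* The midpoint of the segment is interior to the box. *)
- move=> /(_ (point (vertical s) (pos s) ((lo s + hi s) / 2))).
  have [|X [pX X1 X2 X3 X4]] := cov ((lo s + hi s) / 2).
    by apply/andP; lra.
  have [|Y [pY Y1 Y2 Y3 Y4]] := cov (lo s); first by apply/andP; lra.
  have [|Z [pZ Z1 Z2 Z3 Z4]] := cov (hi s); first by apply/andP; lra.
  have [b1 b2] := tile_sub_box D (~~ vertical s) Y.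
  have [b3 b4] := tile_sub_box D (~~ vertical s) Z.
  case.
    rewrite lseg_setP coord_point coordN_point; split=> //.
    by apply/andP; lra.
  move=> _; apply; apply/rect_intP => u.
  have : u = vertical s \/ u = ~~ vertical s.
    by case: (u) (vertical s) => [] []; auto.
  by case=> ->; rewrite ?coord_point ?coordN_point; apply/andP; lra.
Qed.

Lemma rect_sep (R : realType) (A B : rect R) :
  rect_int A `&` rect_int B = set0 ->
  exists v, rhi v A <= rlo v B \/ rhi v B <= rlo v A.
Proof.
move=> disj; apply: contrapT => nsep.
(* The midpoint of the intersection of the two projections. *)
pose m v := (Order.max (rlo v A) (rlo v B) + Order.min (rhi v A) (rhi v B)) / 2.
have Hm v : [/\ rlo v A < m v, m v < rhi v A, rlo v B < m v & m v < rhi v B].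
  have lA := rlo_lt_rhi v A; have lB := rlo_lt_rhi v B.
  have n1 : rlo v B < rhi v A.
    by rewrite ltNge; apply/negP => ?; apply: nsep; exists v; left.
  have n2 : rlo v A < rhi v B.
    by rewrite ltNge; apply/negP => ?; apply: nsep; exists v; right.
  by rewrite /m maxEle minEle; case: ifP; case: ifP => *; split; lra.
have : (rect_int A `&` rect_int B) (m true, m false).
  have [t1 t2 t3 t4] := Hm true; have [f1 f2 f3 f4] := Hm false.
  by split; apply/rect_intP; case; apply/andP.
by rewrite disj.
Qed.

Lemma tile_sepP (R : realType) n (D : decomposition R n) X Y : X <> Y ->
  exists v, rhi v (tile D X) <= rlo v (tile D Y) \/
            rhi v (tile D Y) <= rlo v (tile D X).
Proof. by move/eqP => nXY; apply/rect_sep/tile_disjoint. Qed.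

Lemma covered_union (R : realType) n (D : decomposition R n) v p l h l' h' :
  covered D v p l h -> covered D v p l' h' -> l' <= h -> l <= h' ->
  covered D v p (Order.min l l') (Order.max h h').
Proof.
move=> c c' lh hl b; rewrite ge_min le_max => /andP[b1 b2].
have [bl|bl] := ltP b l.
  have [|X [X1 X2 X3 X4 X5]] := c' b.
    by apply/andP; split; case/orP: b1; case/orP: b2; lra.
  by exists X; split; rewrite ?ge_min ?le_max ?X2 ?X5 ?orbT.
have [bh|bh] := ltP h b.
  have [|X [X1 X2 X3 X4 X5]] := c' b.
    by apply/andP; split; case/orP: b1; case/orP: b2; lra.
  by exists X; split; rewrite ?ge_min ?le_max ?X2 ?X5 ?orbT.
have [|X [X1 X2 X3 X4 X5]] := c b; first by apply/andP.
by exists X; split; rewrite ?ge_min ?le_max ?X2 ?X5 ?orbT.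
Qed.

Lemma covered_tile (R : realType) n (D : decomposition R n) v p X :
  p = rlo v (tile D X) \/ p = rhi v (tile D X) ->
  covered D v p (rlo (~~ v) (tile D X)) (rhi (~~ v) (tile D X)).
Proof. by move=> pX b /andP[b1 b2]; exists X; split. Qed.

(** Adjoining the side of [X] keeps the segment covered, so by maximality it adds nothing. *)
Lemma max_covered_tile (R : realType) n (D : decomposition R n) v p l h X :
  max_covered D v p l h -> p = rlo v (tile D X) \/ p = rhi v (tile D X) ->
  rlo (~~ v) (tile D X) <= h -> l <= rhi (~~ v) (tile D X) ->
  l <= rlo (~~ v) (tile D X) /\ rhi (~~ v) (tile D X) <= h.
Proof.
move=> [_ cov smax _ _] pX h1 h2.
have [||e1 e2] := smax _ _ (covered_union cov (covered_tile pX) h1 h2).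
- by rewrite ge_min lexx.
- by rewrite le_max lexx.
split; first by rewrite -e1 ge_min lexx orbT.
by rewrite -[leRHS]e2 le_max lexx orbT.
Qed.

(** Covered intervals begin and end at ends of tile sides, so there are finitely many candidates
    around the side of [X]; the longest is maximal. *)
Lemma max_covered_exists (R : realType) n (D : decomposition R n) v p X :
  p = rlo v (tile D X) \/ p = rhi v (tile D X) ->
  rlo v (box D) < p -> p < rhi v (box D) ->
  exists l h, [/\ max_covered D v p l h, l <= rlo (~~ v) (tile D X) &
    rhi (~~ v) (tile D X) <= h].
Proof.
move=> pX p1 p2.
pose lo' Y := rlo (~~ v) (tile D Y); pose hi' Y := rhi (~~ v) (tile D Y).
pose P (YZ : 'I_n * 'I_n) := `[< [/\ covered D v p (lo' YZ.1) (hi' YZ.2),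
  lo' YZ.1 <= lo' X & hi' X <= hi' YZ.2] >].
have PX : P (X, X) by apply/asboolP; split=> //; exact: covered_tile.
have ltX : lo' X < hi' X := rlo_lt_rhi _ _.
case: (@Order.TotalTheory.arg_maxP _ R _ (X, X) P
  (fun YZ => hi' YZ.2 - lo' YZ.1) PX).
move=> [Y Z] /asboolP[/= cov lX Xh] maxYZ.
exists (lo' Y), (hi' Z); split=> //; split=> //; first by lra.
move=> l h cov' ll hh.
have [|Y' [Y1 Y2 Y3 Y4 Y5]] := cov' l; first by apply/andP; lra.
have [|Z' [Z1 Z2 Z3 Z4 Z5]] := cov' h; first by apply/andP; lra.
have eY : l = lo' Y' by rewrite /lo'; lra.
have eZ : h = hi' Z' by rewrite /hi'; lra.
have := maxYZ (Y', Z'); rewrite /= -eY -eZ => maxl.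
have : hi' Z - lo' Y >= h - l.
  by apply: maxl; apply/asboolP; rewrite /= -eY -eZ; split=> //; lra.
by lra.
Qed.

(** Otherwise some tile has a side on the segment passing through the interior of [X], so its
    interior meets that of [X]. *)
Lemma max_covered_avoid (R : realType) n (D : decomposition R n) v p l h X :
  max_covered D v p l h -> rlo v (tile D X) < p -> p < rhi v (tile D X) ->
  h <= rlo (~~ v) (tile D X) \/ rhi (~~ v) (tile D X) <= l.
Proof.
move=> [lh cov _ _ _] p1 p2.
have [|hX] := leP h (rlo (~~ v) (tile D X)); first by left.
have [|Xl] := leP (rhi (~~ v) (tile D X)) l; first by right.
have ltX := rlo_lt_rhi (~~ v) (tile D X).
pose b := (Order.max l (rlo (~~ v) (tile D X)) +
  Order.min h (rhi (~~ v) (tile D X))) / 2.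
have [b1 b2 b3 b4] : [/\ l < b, b < h, rlo (~~ v) (tile D X) < b &
    b < rhi (~~ v) (tile D X)].
  by rewrite /b maxEle minEle; case: ifP; case: ifP => *; split; lra.
have [|Y [pY Y1 Y2 Y3 Y4]] := cov b; first by apply/andP; lra.
have ltY := rlo_lt_rhi v (tile D Y).
have nXY : X <> Y by move=> e; rewrite -e in pY; lra.
have ltY' := rlo_lt_rhi (~~ v) (tile D Y).
have [u] := tile_sepP D nXY.
have : u = v \/ u = ~~ v by case: (u) (v) => [] []; auto.
by case=> ->; lra.
Qed.

Lemma max_covered_nocross (R : realType) n (Q : rectangulation R n)
    v p l h q l' h' :
  max_covered Q v p l h -> max_covered Q (~~ v) q l' h' ->
  l < q -> q < h -> l' < p -> p < h' -> False.
Proof.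
wlog -> : v p l h q l' h' / v = true.
  move=> W; case: v => *; first exact: (W true p l h q l' h').
  exact: (W true q l' h' p l h).
move=> s t q1 q2 p1 p2.
have lh : l < h by case: s.
have lh' : l' < h' by case: t.
have e : lseg_int (LSeg true p lh) `&` lseg_int (LSeg false q lh') = set0.
  by apply: (@decomp_generic R n Q) => //; apply/is_segmentP.
suff : set0 (p, q) by [].
by rewrite -e; split; apply/lseg_intP; split=> //; apply/andP.
Qed.

(** * The tiling of a rectangulation *)

Definition tiling_of (R : realType) n (Q : rectangulation R n) : tiling R n.
Proof.
apply: (@Tiling R n (fun v X => rlo v (tile Q X)) (fun v X => rhi v (tile Q X))
  (fun v => rlo v (box Q)) (fun v => rhi v (box Q)) (max_covered Q)).
- by move=> v X; apply: rlo_lt_rhi.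
- by move=> v X; apply: tile_sub_box.
- by move=> X Y; apply: tile_sepP.
- move=> a Ha.
  have : rect_set (box Q) (a true, a false).
    by move: (Ha true) (Ha false) => h1 h2; apply/rect_setP; case; apply/andP.
  rewrite -(tile_cover Q) => -[X _ /rect_setP HX]; exists X.
  by move: (HX true) (HX false) => hT hF; case; apply/andP.
- move=> v p l h [lh cov _ p1 p2].
  have [|Y [_ Y1 Y2 Y3 Y4]] := cov l; first by apply/andP; lra.
  have [|Z [_ Z1 Z2 Z3 Z4]] := cov h; first by apply/andP; lra.
  have [b1 b2] := tile_sub_box Q (~~ v) Y.
  have [b3 b4] := tile_sub_box Q (~~ v) Z.
  by split=> //; lra.
- exact: max_covered_avoid.
- exact: max_covered_tile.
- exact: max_covered_exists.
- exact: max_covered_nocross.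
Defined.

Lemma left_stepP (R : realType) n (Q : rectangulation R n) X Y :
  left_step Q X Y <-> step (tiling_of Q) true X Y.
Proof.
split=> [[s []]|].
  move=> /is_segmentP h1 h2 /lseg_subP[/= e1 e2 e3 e4].
  move=> /lseg_subP[/= _ e5 e6 e7].
  rewrite -e1 -e2 in h1; exists (lo s), (hi s); split=> //.
  by transitivity (pos s).
move=> [l [h [/= s e [X1 X2] [Y1 Y2]]]].
have lh : l < h by case: s.
exists (LSeg true (xhi (tile Q X)) lh); split=> //; first exact/is_segmentP.
  by apply/lseg_subP.
by apply/lseg_subP.
Qed.

Lemma below_stepP (R : realType) n (Q : rectangulation R n) X Y :
  below_step Q X Y <-> step (tiling_of Q) false X Y.
Proof.
split=> [[s []]|].
  move=> /is_segmentP h1 h2 /lseg_subP[/= e1 e2 e3 e4].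
  move=> /lseg_subP[/= _ e5 e6 e7].
  rewrite -e1 -e2 in h1; exists (lo s), (hi s); split=> //.
  by transitivity (pos s).
move=> [l [h [/= s e [X1 X2] [Y1 Y2]]]].
have lh : l < h by case: s.
exists (LSeg false (yhi (tile Q X)) lh); split=> //; first exact/is_segmentP.
  by apply/lseg_subP.
by apply/lseg_subP.
Qed.

Lemma clos_trans_iff (T : Type) (r r' : T -> T -> Prop) x y :
  (forall x y, r x y <-> r' x y) -> clos_trans _ r x y <-> clos_trans _ r' x y.
Proof.
move=> rr'; split; elim=> {}x {}y.
- by move/rr'; apply: t_step.
- by move=> z _ h1 _ h2; apply: t_trans h1 h2.
- by move/rr'; apply: t_step.
- by move=> z _ h1 _ h2; apply: t_trans h1 h2.
Qed.

Lemma left_ofP (R : realType) n (Q : rectangulation R n) X Y :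
  left_of Q X Y <-> chain (tiling_of Q) true X Y.
Proof. exact: clos_trans_iff (@left_stepP R n Q). Qed.

Lemma belowP (R : realType) n (Q : rectangulation R n) X Y :
  below Q X Y <-> chain (tiling_of Q) false X Y.
Proof. exact: clos_trans_iff (@below_stepP R n Q). Qed.

Lemma avoids_topP (R : realType) n (Q : rectangulation R n) :
  avoids_top Q <->
  ~ exists X Y Z, [/\ left_of Q X Y, below Q X Z & below Q Y Z].
Proof.
have -> : (exists X Y Z, [/\ left_of Q X Y, below Q X Z & below Q Y Z]) <->
    has_top (tiling_of Q).
  rewrite has_topP; split=> -[X [Y [Z [XY XZ YZ]]]]; exists X, Y, Z;
    by split; first [exact/left_ofP | exact/belowP].
suff e : (exists s t : lseg R, [/\ is_segment Q s, vertical s,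
      is_segment Q t, ~~ vertical t & lseg_int t (pos s, hi s)]) <->
    has_top (tiling_of Q).
  by rewrite /avoids_top e.
split=> [[s [t [/is_segmentP s1 s2 /is_segmentP t1 t2 /lseg_intP]]]|].
  rewrite s2 in s1; rewrite (negPf t2) in t1 *.
  rewrite /coord /= => -[e /andP[h1 h2]].
  by rewrite -e in t1; exists (pos s), (lo s), (hi s), (lo t), (hi t).
move=> [p [l [h [l' [h' [s t h1 h2]]]]]].
have lh : l < h by case: s.
have lh' : l' < h' by case: t.
exists (LSeg true p lh), (LSeg false h lh'); split=> //;
  try exact/is_segmentP.
by apply/lseg_intP; split=> //; apply/andP.
Qed.

(** * Linear orders, rankings and the permutation *)

Lemma ranking_exists n (prec : 'I_n -> 'I_n -> Prop) :
  (forall X, ~ prec X X) ->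
  (forall X Y Z, prec X Y -> prec Y Z -> prec X Z) ->
  (forall X Y, X <> Y -> prec X Y \/ prec Y X) ->
  exists r, is_ranking prec r.
Proof.
move=> irr tr tot.
pose before X := [pred Z | `[< prec Z X >]].
have rank_lt X : (#|before X| < n)%N.
  rewrite -[X in (_ < X)%N]card_ord; apply: proper_card; apply/properP.
  split; first by apply/fintype.subsetP.
  by exists X => //; rewrite inE; apply/asboolP.
have mono X Y : prec X Y -> (#|before X| < #|before Y|)%N.
  move=> XY; apply: proper_card; apply/properP; split.
    apply/fintype.subsetP => Z; rewrite !inE => ZX; exact: tr ZX XY.
  by exists X; rewrite !inE; [|apply/asboolPn/irr].
have inj : injective (fun X => Ordinal (rank_lt X)).
  move=> X Y /(congr1 val) /= e; apply: contrapT => nXY.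
  by case: (tot _ _ nXY) => /mono; rewrite e ltnn.
exists (perm inj) => X Y; rewrite !permE /=; split; first exact: mono.
move=> lt; have [e|/eqP nXY] := eqVneq X Y; first by rewrite e ltnn in lt.
by case: (tot _ _ nXY) => // /mono; rewrite ltnNge (ltnW lt).
Qed.

(** The mixed case of transitivity: if [l X Y] and [b Y Z], then [l Z X] would give [l Z Y], and
    [b Z X] would give [b Y X], both against exclusivity. *)
Lemma strict_linear_of_exclusive (I : Type) (l b : I -> I -> Prop) :
  (forall X, ~ l X X) -> (forall X, ~ b X X) ->
  (forall X Y Z, l X Y -> l Y Z -> l X Z) ->
  (forall X Y Z, b X Y -> b Y Z -> b X Z) ->
  (forall X Y, X <> Y -> l X Y \/ l Y X \/ b X Y \/ b Y X) ->
  (forall X Y, l X Y \/ l Y X -> b X Y \/ b Y X -> False) ->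
  [/\ forall X, ~ (l X X \/ b X X),
    forall X Y Z, l X Y \/ b X Y -> l Y Z \/ b Y Z -> l X Z \/ b X Z &
    forall X Y, X <> Y -> (l X Y \/ b X Y) \/ (l Y X \/ b Y X)].
Proof.
move=> irl irb trl trb tot excl; split=> [X|X Y Z|X Y /tot]; last by tauto.
  by case; [exact: irl|exact: irb].
have [->|nXZ] := pselect (X = Z).
  move=> [h|h] [h'|h']; exfalso.
  - exact: irl (trl _ _ _ h h').
  - by apply: (@excl Z Y); auto.
  - by apply: (@excl Z Y); auto.
  - exact: irb (trb _ _ _ h h').
move=> [h|h] [h'|h'].
- by left; apply: trl _ _ _ h h'.
- case: (tot _ _ nXZ) => [?|[c|[?|c]]]; [by left| |by right|]; exfalso.
    by apply: (@excl Z Y); [left; apply: trl _ _ _ c h|right].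
  by apply: (@excl X Y); [left|right; apply: trb _ _ _ h' c].
- case: (tot _ _ nXZ) => [?|[c|[?|c]]]; [by left| |by right|]; exfalso.
    by apply: (@excl X Y); [right; apply: trl _ _ _ h' c|left].
  by apply: (@excl Z Y); [right|left; apply: trb _ _ _ c h].
- by right; apply: trb _ _ _ h h'.
Qed.

Lemma left_of_irrefl (R : realType) n (Q : rectangulation R n) X :
  ~ left_of Q X X.
Proof.
by move=> /left_ofP/chain_le; have := tlo_lt_thi (tiling_of Q) true X; lra.
Qed.

Lemma below_irrefl (R : realType) n (Q : rectangulation R n) X :
  ~ below Q X X.
Proof.
by move=> /belowP/chain_le; have := tlo_lt_thi (tiling_of Q) false X; lra.
Qed.

Lemma left_below_total (R : realType) n (Q : rectangulation R n) X Y :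
  X <> Y -> left_of Q X Y \/ left_of Q Y X \/ below Q X Y \/ below Q Y X.
Proof.
move=> /(chain_comparable_unique (tiling_of Q))[v].
by rewrite !left_ofP !belowP; case: v => /=; tauto.
Qed.

Lemma left_below_exclusive (R : realType) n (Q : rectangulation R n) X Y :
  left_of Q X Y \/ left_of Q Y X -> below Q X Y \/ below Q Y X -> False.
Proof.
have [<-|nXY] := pselect (X = Y).
  by have := @left_of_irrefl R n Q X; tauto.
have [v] := chain_comparable_unique (tiling_of Q) nXY.
by rewrite !left_ofP !belowP; case: v => /=; tauto.
Qed.

Lemma is_beta_exists (R : realType) n (Q : rectangulation R n) :
  exists p, is_beta Q p.
Proof.
have tr : forall X Y Z, left_of Q X Y -> left_of Q Y Z -> left_of Q X Z.
  by move=> X Y Z; apply: t_trans.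
have tr' : forall X Y Z, below Q X Y -> below Q Y Z -> below Q X Z.
  by move=> X Y Z; apply: t_trans.
have [i1 t1 c1] := strict_linear_of_exclusive (@left_of_irrefl R n Q)
  (@below_irrefl R n Q) tr tr' (@left_below_total R n Q)
  (@left_below_exclusive R n Q).
have [i2 t2 c2] : [/\ forall X, ~ se_nw Q X X,
    forall X Y Z, se_nw Q X Y -> se_nw Q Y Z -> se_nw Q X Z &
    forall X Y, X <> Y -> se_nw Q X Y \/ se_nw Q Y X].
  apply: strict_linear_of_exclusive => //.
  - exact: left_of_irrefl.
  - exact: below_irrefl.
  - by move=> X Y Z h1 h2; apply: tr _ _ _ h2 h1.
  - by move=> X Y /(@left_below_total R n Q); rewrite /right_of; tauto.
  - by move=> X Y h; apply: left_below_exclusive; rewrite /right_of in h; tauto.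
have [position rp] := ranking_exists i1 t1 c1.
have [label rl] := ranking_exists i2 t2 c2.
(* The left factor acts first: a position goes to its tile, then to the label. *)
exists (position^-1 * label)%g, label, position; split=> // X.
by rewrite permM permK.
Qed.

(** Tiles in the same order in both rankings are related vertically, those in opposite orders
    horizontally. A 213 has one inversion, [X] left of [Y], and [Z] comes last in both orders. *)
Lemma avoids_213P (R : realType) n (Q : rectangulation R n) p :
  is_beta Q p -> avoids_213 p <->
  ~ exists X Y Z, [/\ left_of Q X Y, below Q X Z & below Q Y Z].
Proof.
move=> [label [position [rl rp plabel]]]; rewrite /avoids_213.
split=> no [i [j [k]]].
  move=> [XY XZ YZ]; apply: no; exists (position i), (position j), (position k).
  rewrite !plabel; split.
  - by apply/rp; left.
  - by apply/rp; right.
  - by apply/rl; left.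
  - by apply/rl; right.
rewrite -(permKV position i) -(permKV position j) -(permKV position k) !plabel.
move: (_ i) (_ j) (_ k) => X Y Z [XY YZ YX XZ]; apply: no; exists X, Y, Z.
have /rp := ltn_trans XY YZ; have /rl := ltn_trans YX XZ.
move/rp: XY; move/rp: YZ; move/rl: YX; move/rl: XZ.
rewrite /sw_ne /se_nw /right_of.
have asym U V : left_of Q U V -> left_of Q V U -> False.
  by move=> h1 h2; apply: (@left_of_irrefl R n Q U); apply: t_trans h1 h2.
have asym' U V : below Q U V -> below Q V U -> False.
  by move=> h1 h2; apply: (@below_irrefl R n Q U); apply: t_trans h1 h2.
have := @left_below_exclusive R n Q X Y.
have := @left_below_exclusive R n Q X Z.
have := @left_below_exclusive R n Q Y Z.
have := asym' X Y; have := asym X Z; have := asym Y Z.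
by split; tauto.
Qed.

Lemma weakly_equivalent_pattern (R : realType) n (Q Q' : rectangulation R n) :
  weakly_equivalent Q Q' ->
  (exists X Y Z, [/\ left_of Q X Y, below Q X Z & below Q Y Z]) <->
  (exists X Y Z, [/\ left_of Q' X Y, below Q' X Z & below Q' Y Z]).
Proof.
move=> [f Hf]; split=> -[X [Y [Z [h1 h2 h3]]]].
  by exists (f X), (f Y), (f Z); split; apply Hf.
by exists (f^-1 X)%g, (f^-1 Y)%g, (f^-1 Z)%g; split; apply Hf; rewrite !permKV.
Qed.

Theorem theorem2 (R : realType) (n : nat) (W : weak_rectangulation R n)
    (Q : rectangulation R n) (hQ : weak_class W Q) :
  avoids_top Q <-> avoids_213 (beta W).
Proof.
have [Q0 eW] := weak_classP W.
(* The set in [beta] is nonempty, so [xget] picks the permutation of some representative, perhaps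
   not [Q]. *)
have [Q' WQ' bQ'] : exists2 Q', weak_class W Q' & is_beta Q' (beta W).
  have [p bp] := is_beta_exists Q.
  have : [set p | exists2 Q, weak_class W Q & is_beta Q p] p by exists Q.
  exact: xgetI.
rewrite avoids_topP (avoids_213P bQ').
rewrite eW /= in hQ WQ'.
(* Both representatives are compared with [Q0], to which they are weakly equivalent. *)
by rewrite -(weakly_equivalent_pattern hQ) -(weakly_equivalent_pattern WQ').
Qed.
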